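(* Suppose that $1\eqsim\alpha\ge\alpha_0$ and $\lambda^{-1}\eqsim\beta\ge\beta_0$. Let $(u,y,p)\in X_{\mathrm{ad}}\times Y\times Y^\star$ denote the unique solution of $$a(u,y,p;\,v-u,z-y,q-p)\ge\ell(v-u,z-y,q-p)\qquad\text{for all }(v,z,q)\in X_{\mathrm{ad}}\times Y\times Y^\star.$$ Let $X_{h,\mathrm{ad}}\subset X_{\mathrm{ad}}$ be a non-empty closed convex subset and let $Y_h\subset Y$, $Y_h^\star\subset Y^\star$ be closed subspaces. Let $(u_h,y_h,p_h)\in X_{h,\mathrm{ad}}\times Y_h\times Y_h^\star$ be an arbitrary element and define $$\widetilde u_h=\Pi_{X_{\mathrm{ad}}}\big(\lambda^{-1}\mathcal{C}^{-1}\mathcal{B}^*\mathcal{I}^\star p_h\big).$$ Then the estimator $\eta\ge0$ given by $$\eta^2=\alpha\|\mathcal{L}y_h+\mathcal{B}u_h-f\|_Z^2+\beta\|\mathcal{L}^\star p_h-\mathcal{A}^*(\mathcal{A}\mathcal{I}y_h-z_d)\|_Z^2+\lambda\|\widetilde u_h-u_h\|_X^2$$ is reliable and efficient in the sense that $$\lambda\|(u-u_h,y-y_h,p-p_h)\|_{X\times Y\times Y^\star}\lesssim\eta\lesssim\lambda^{-1/2}\|(u-u_h,y-y_h,p-p_h)\|_{X\times Y\times Y^\star}.$$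
   Context: All Hilbert spaces are real; $(\cdot,\cdot)_V$ and $\|\cdot\|_V$ denote the inner product and norm of a Hilbert space $V$; products carry the norm $\|(x_1,\dots,x_n)\|^2=\sum_j\|x_j\|^2$. Let $H,X,Y,Y^\star$ be Hilbert spaces ($Y^\star$ is simply another Hilbert space, not necessarily the dual of $Y$), let $X_{\mathrm{ad}}\subseteq X$ be non-empty, closed and convex, and let $Z=\boldsymbol{L}^2(\Omega_1)\times\cdots\times\boldsymbol{L}^2(\Omega_n)$, where $\Omega_1,\dots,\Omega_n$ are Lipschitz domains and each $\boldsymbol{L}^2(\Omega_j)$ is a Lebesgue space of square-integrable scalar- or vector-valued functions. Let $\mathcal{A}\colon Z\to H$, $\mathcal{B}\colon X\to Z$, $\mathcal{C}\colon X\to X$ be bounded linear operators with (Hilbert space) adjoints $\mathcal{A}^*\colon H\to Z$, $\mathcal{B}^*\colon Z\to X$, where $\mathcal{C}=\mathcal{C}^*$ and there is $\kappa>0$ with $(\mathcal{C}u,u)_X\ge\kappa\|u\|_X^2$ for all $u\in X$. Let $\mathcal{L}\colon Y\to Z$ and $\mathcal{L}^\star\colon Y^\star\to Z$ be bounded linear bijections, and let $\mathcal{I}\colon Y\to Z$, $\mathcal{I}^\star\colon Y^\star\to Z$ be bounded linear operators with $(\mathcal{L}y,\mathcal{I}^\star p)_Z=(\mathcal{I}y,\mathcal{L}^\star p)_Z$ for all $y\in Y$, $p\in Y^\star$. Let $0<\lambda\le1$, $f\in Z$, $z_d\in H$. $\Pi_{X_{\mathrm{ad}}}\colon X\to X_{\mathrm{ad}}$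 denotes the (in general nonlinear) projection onto the closed convex set $X_{\mathrm{ad}}$ with respect to the inner product $(u,v)_{\mathcal{C}}:=(\mathcal{C}u,v)_X$ on $X$. For $u\in X$, $y\in Y$ let $y_u\in Y$ and $p_y\in Y^\star$ be the unique solutions of $\mathcal{L}y_u=-\mathcal{B}u$ and $\mathcal{L}^\star p_y=\mathcal{A}^*\mathcal{A}\mathcal{I}y$. Define the norm $$|\!|\!|(u,y,p)|\!|\!|_\lambda^2=\lambda\|u\|_X^2+\|y-y_u\|_Y^2+\lambda^{-1}\|p-p_y\|_{Y^\star}^2+\|\mathcal{A}\mathcal{I}y_u\|_H^2.$$ For constants $\alpha,\beta>0$ and $u,v\in X$, $y,z\in Y$, $p,q\in Y^\star$ define \begin{align*} a(u,y,p;v,z,q)&=\alpha(\mathcal{L}y+\mathcal{B}u,\mathcal{L}z+\mathcal{B}v)_Z+\beta(\mathcal{L}^\star p-\mathcal{A}^*\mathcal{A}\mathcal{I}y,\mathcal{L}^\star q-\mathcal{A}^*\mathcal{A}\mathcal{I}z)_Z+(-\mathcal{B}^*\mathcal{I}^\star p+\lambda\mathcal{C}u,v)_X,\\ \ell(v,z,q)&=\alpha(f,\mathcal{L}z+\mathcal{B}v)_Z+\beta(-\mathcal{A}^*z_d,\mathcal{L}^\star q-\mathcal{A}^*\mathcal{A}\mathcal{I}z)_Z. \end{align*} $A\lesssim B$ means $A\le C\,B$ with a constant $C>0$ independent of $\lambda\in(0,1]$, of the elements of the spaces and the data involved, and of the discrete sets $X_{h,\mathrm{ad}},Y_h,Y_h^\star$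 (the underlying spaces and operators being fixed; $C$ may depend on the constants in $\alpha\eqsim1$, $\beta\eqsim\lambda^{-1}$); $A\eqsim B$ means $A\lesssim B\lesssim A$. Thresholds: $\alpha_0,\beta_0>0$ (possibly depending on $\lambda$) with $\alpha_0\eqsim1$, $\beta_0\eqsim\lambda^{-1}$ are fixed such that for all $\alpha\ge\alpha_0$, $\beta\ge\beta_0$ and all $(u,y,p),(v,z,q)\in X\times Y\times Y^\star$ one has, with constants independent of $\lambda,\alpha,\beta$, $|\!|\!|(u,y,p)|\!|\!|_\lambda^2\lesssim a(u,y,p;u,y,p)$ and $|a(u,y,p;v,z,q)|\lesssim\max\{\alpha,\lambda\beta\}|\!|\!|(u,y,p)|\!|\!|_\lambda|\!|\!|(v,z,q)|\!|\!|_\lambda$; in particular the variational inequality for $a,\ell$ on any non-empty closed convex subset of $X\times Y\times Y^\star$ has a unique solution. *)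

(* Defs.v *)
From HB Require Import structures.
From mathcomp Require Import all_boot all_order all_algebra.
From mathcomp Require Import sesquilinear.
From mathcomp Require Import all_classical all_reals all_analysis.

Set Implicit Arguments.
Unset Strict Implicit.
Unset Printing Implicit Defensive.
Import Order.TTheory GRing.Theory Num.Theory.
Import numFieldNormedType.Exports.
Local Open Scope classical_set_scope.
Local Open Scope ring_scope.

HB.mixin Record CompleteNormedModule_isHilbert (R : realType) V
    of CompleteNormedModule R V := {
  inner : {dot V for idfun} ;
  normr_inner : forall x : V, `|x| ^+ 2 = inner x x }.

#[short(type="hilbertType")]
HB.structure Definition Hilbert (R : realType) :=
  {V of CompleteNormedModule_isHilbert R V & CompleteNormedModule R V}.

Definition ip (R : realType) (V : hilbertType R) (x y : V) : R :=
  (inner : {dot V for idfun}) x y.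

Definition is_adjoint (R : realType) (V W : hilbertType R)
    (T : V -> W) (T' : W -> V) : Prop :=
  forall x y, ip (T x) y = ip x (T' y).

Definition closed_subspace (R : realType) (V : hilbertType R) (E : set V) : Prop :=
  [/\ closed E, E 0 & forall (a : R) x y, E x -> E y -> E (a *: x + y)].

Definition closed_convex (R : realType) (V : hilbertType R) (K : set V) : Prop :=
  [/\ K !=set0, closed K & @convex_set R V K].

(* Lebesgue measure on R^d, as the iterated product of the one-dimensional
   one; R^0 is a point of mass 1. *)
Definition tuple_cons (T : Type) (d : nat) (p : d.-tuple T * T) : d.+1.-tuple T :=
  [the d.+1.-tuple T of p.2 :: p.1].

Lemma measurable_tuple_cons (R : realType) (d : nat) :
  measurable_fun [set: d.-tuple R * R] (@tuple_cons R d).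
Proof. exact: (measurable_cons measurable_snd measurable_fst). Qed.

Section lebesgue_step.
Context (R : realType) (d : nat) (m : {measure set (d.-tuple R) -> \bar R}).

Definition lebesgue_step : set (d.+1.-tuple R) -> \bar R :=
  pushforward (m \x lebesgue_measure)%E (@tuple_cons R d).

Let mcons := @measurable_tuple_cons R d.

Let lebesgue_step0 : lebesgue_step set0 = 0%E.
Proof. by rewrite /lebesgue_step /pushforward preimage_set0 measure0. Qed.

Let lebesgue_step_ge0 A : (0 <= lebesgue_step A)%E.
Proof. exact: measure_ge0. Qed.

Let lebesgue_step_sigma_additive : semi_sigma_additive lebesgue_step.
Proof.
move=> F mF tF mUF; rewrite /lebesgue_step /pushforward preimage_bigcup.
apply: measure_semi_sigma_additive.
- by move=> n; rewrite -[X in measurable X]setTI; exact: mcons.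
- apply/trivIsetP => /= i j _ _ ij; rewrite -preimage_setI.
  by move/trivIsetP : tF => /(_ _ _ _ _ ij) ->//; rewrite preimage_set0.
- by rewrite -preimage_bigcup -[X in measurable X]setTI; exact: mcons.
Qed.

HB.instance Definition _ := isMeasure.Build _ _ _ lebesgue_step
  lebesgue_step0 lebesgue_step_ge0 lebesgue_step_sigma_additive.

End lebesgue_step.

Fixpoint lebesgue_tuple (R : realType) (d : nat) :
    {measure set (d.-tuple R) -> \bar R} :=
  match d return {measure set (d.-tuple R) -> \bar R} with
  | 0 => [the {measure set (0.-tuple R) -> \bar R} of dirac [tuple]]
  | d'.+1 => [the {measure set (d'.+1.-tuple R) -> \bar R} of
      lebesgue_step (lebesgue_tuple R d')]
  end.

(* Topology lives on row vectors, the Borel structure on tuples. *)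
Definition vec (R : realType) (d : nat) (x : d.-tuple R) : 'rV[R]_d :=
  \row_i tnth x i.

(* Near every boundary point x0, after a linear isometry and a shift, Om is the strict
   epigraph (in the last coordinate) of a Lipschitz function.  Boundedness of
   Om is not required. *)
Definition lipschitz_domain (R : realType) (d : nat) (Om : set 'rV[R]_d.+1) : Prop :=
  [/\ Om !=set0, open Om, connected Om &
      forall x0, (closure Om `\` Om) x0 ->
      exists (Q : 'M[R]_d.+1) (g : 'rV[R]_d -> R) (r : R),
        [/\ Q *m Q^T = 1%:M, [lipschitz g s | s in setT], 0 < r &
            forall x, ball x0 r x ->
              let y := (x - x0) *m Q in
              Om x <-> g (col' ord_max y) < y 0 ord_max]].

Definition square_integrable (R : realType) (n : nat) (d m : 'I_n -> nat)
    (Om : forall j, set 'rV[R]_(d j))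
    (f : forall j, 'rV[R]_(d j) -> 'rV[R]_(m j)) : Prop :=
  forall j (k : 'I_(m j)),
    measurable_fun (@vec R (d j) @^-1` Om j) (fun x => f j (vec x) 0 k) /\
    (\int[lebesgue_tuple R (d j)]_(x in @vec R (d j) @^-1` Om j)
        ((f j (vec x) 0 k) ^+ 2)%:E < +oo)%E.

(* Z is L^2(Om_1; R^(m_1)) x ... x L^2(Om_n; R^(m_n)): cls sends a
   square-integrable family to its class modulo a.e. equality; that cls f = cls g
   exactly when f = g a.e. follows from the inner product formula. *)
Definition is_L2_product (R : realType) (n : nat) (d m : 'I_n -> nat)
    (Om : forall j, set 'rV[R]_(d j)) (Z : hilbertType R) : Prop :=
  exists cls : (forall j, 'rV[R]_(d j) -> 'rV[R]_(m j)) -> Z,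
  [/\ forall z, exists2 f, square_integrable Om f & cls f = z,
      forall (a : R) f g, square_integrable Om f -> square_integrable Om g ->
        cls (fun j x => a *: f j x + g j x) = a *: cls f + cls g &
      forall f g, square_integrable Om f -> square_integrable Om g ->
        ip (cls f) (cls g) =
        \sum_(j < n) \sum_(k < m j)
          \int[lebesgue_tuple R (d j)]_(x in @vec R (d j) @^-1` Om j)
            (f j (vec x) 0 k * g j (vec x) 0 k)].

(* The successors make each domain dimension and each number of components
   positive.  opA' and opB' are the adjoints of opA and opB, whereas opLs and opIs, on
   spYs, are unrelated to adjoints apart from opL_opI. *)
Record setting (R : realType) := Setting {
  spH : hilbertType R;
  spX : hilbertType R;
  spY : hilbertType R;
  spYs : hilbertType R;
  spZ : hilbertType R;
  nOm : nat;
  nOm_gt0 : (0 < nOm)%N;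
  dimOm : 'I_nOm -> nat;
  Om : forall j, set 'rV[R]_(dimOm j).+1;
  Om_lipschitz : forall j, lipschitz_domain (@Om j);
  ncomp : 'I_nOm -> nat;
  spZ_L2 : @is_L2_product R nOm (fun j => (dimOm j).+1)
             (fun j => (ncomp j).+1) (@Om) spZ;
  Xad : set spX;
  Xad_closed_convex : closed_convex Xad;
  opA : {linear spZ -> spH};
  opA' : {linear spH -> spZ};
  opB : {linear spX -> spZ};
  opB' : {linear spZ -> spX};
  opC : {linear spX -> spX};
  opL : {linear spY -> spZ};
  opLs : {linear spYs -> spZ};
  opI : {linear spY -> spZ};
  opIs : {linear spYs -> spZ};
  opA_bounded : bounded_near opA (nbhs 0);
  opB_bounded : bounded_near opB (nbhs 0);
  opC_bounded : bounded_near opC (nbhs 0);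
  opL_bounded : bounded_near opL (nbhs 0);
  opLs_bounded : bounded_near opLs (nbhs 0);
  opI_bounded : bounded_near opI (nbhs 0);
  opIs_bounded : bounded_near opIs (nbhs 0);
  opA_adjoint : is_adjoint opA opA';
  opB_adjoint : is_adjoint opB opB';
  opC_selfadjoint : is_adjoint opC opC;
  opC_coercive : exists2 kappa : R, 0 < kappa &
    forall u, kappa * `|u| ^+ 2 <= ip (opC u) u;
  opL_bijective : bijective opL;
  opLs_bijective : bijective opLs;
  opL_opI : forall y p, ip (opL y) (opIs p) = ip (opI y) (opLs p)
}.

Arguments Xad [R] s _.

Section forms.
Context (R : realType) (S : setting R).
Implicit Types (u v : spX S) (y z : spY S) (p q : spYs S) (lambda : R).

(* The default 0 of xget is never reached below: opL and opLs are bijective,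
   opC is coercive, and Xad is non-empty, closed and convex. *)
Definition state u : spY S := xget 0 [set y | opL S y = - opB S u].

Definition costate y : spYs S :=
  xget 0 [set p | opLs S p = opA' S (opA S (opI S y))].

Definition opC_inv (w : spX S) : spX S := xget 0 [set u | opC S u = w].

Definition ipC u v : R := ip (opC S u) v.

Definition projXad (w : spX S) : spX S :=
  xget 0 [set u | Xad S u /\
                  forall v, Xad S v -> ipC (u - w) (u - w) <= ipC (v - w) (v - w)].

Definition lambda_norm lambda u y p : R :=
  Num.sqrt (lambda * `|u| ^+ 2 + `|y - state u| ^+ 2
            + lambda^-1 * `|p - costate y| ^+ 2
            + `|opA S (opI S (state u))| ^+ 2).

Definition prod_norm u y p : R :=
  Num.sqrt (`|u| ^+ 2 + `|y| ^+ 2 + `|p| ^+ 2).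

Definition a_form lambda (alpha beta : R) u y p v z q : R :=
  alpha * ip (opL S y + opB S u) (opL S z + opB S v)
  + beta * ip (opLs S p - opA' S (opA S (opI S y)))
              (opLs S q - opA' S (opA S (opI S z)))
  + ip (- opB' S (opIs S p) + lambda *: opC S u) v.

Definition l_form (alpha beta : R) (f : spZ S) (zd : spH S) v z q : R :=
  alpha * ip f (opL S z + opB S v)
  + beta * ip (- opA' S zd) (opLs S q - opA' S (opA S (opI S z))).

Definition is_VI_solution lambda (alpha beta : R) (f : spZ S) (zd : spH S)
    u y p : Prop :=
  Xad S u /\
  forall v z q, Xad S v ->
    l_form alpha beta f zd (v - u) (z - y) (q - p)
    <= a_form lambda alpha beta u y p (v - u) (z - y) (q - p).

Definition u_tilde lambda p : spX S :=
  projXad (lambda^-1 *: opC_inv (opB' S (opIs S p))).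

Definition estimator lambda (alpha beta : R) (f : spZ S) (zd : spH S) u y p : R :=
  Num.sqrt (alpha * `|opL S y + opB S u - f| ^+ 2
            + beta * `|opLs S p - opA' S (opA S (opI S y) - zd)| ^+ 2
            + lambda * `|u_tilde lambda p - u| ^+ 2).

Definition eqsim (F G : R -> R) : Prop :=
  exists c C : R, [/\ 0 < c, 0 < C &
    forall lambda, 0 < lambda <= 1 ->
      c * G lambda <= F lambda <= C * G lambda].

Definition coercive_above (alpha0 beta0 : R -> R) : Prop :=
  exists2 c : R, 0 < c &
  forall lambda alpha beta, 0 < lambda <= 1 ->
    alpha0 lambda <= alpha -> beta0 lambda <= beta ->
    forall u y p,
      lambda_norm lambda u y p ^+ 2 <= c * a_form lambda alpha beta u y p u y p.

Definition continuous_above (alpha0 beta0 : R -> R) : Prop :=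
  exists2 c : R, 0 < c &
  forall lambda alpha beta, 0 < lambda <= 1 ->
    alpha0 lambda <= alpha -> beta0 lambda <= beta ->
    forall u y p v z q,
      `|a_form lambda alpha beta u y p v z q|
      <= c * Num.max alpha (lambda * beta)
           * (lambda_norm lambda u y p * lambda_norm lambda v z q).

Definition thresholds (alpha0 beta0 : R -> R) : Prop :=
  [/\ eqsim alpha0 (fun=> 1), eqsim beta0 (fun lambda => lambda^-1),
      coercive_above alpha0 beta0 & continuous_above alpha0 beta0].

End forms.

(* Main.v *)
Require Import Defs.
From HB Require Import structures.
From mathcomp Require Import all_boot all_order all_algebra.
From mathcomp Require Import sesquilinear.
From mathcomp Require Import all_classical all_reals all_analysis.
From mathcomp Require Import ring lra.

Set Implicit Arguments.
Unset Strict Implicit.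
Unset Printing Implicit Defensive.
Import Order.TTheory GRing.Theory Num.Theory.
Import numFieldNormedType.Exports.
Local Open Scope classical_set_scope.
Local Open Scope ring_scope.

(** Testing the variational inequality with arbitrary states and costates shows
    that its solution [(u, y, p)] satisfies the state equation
    [L y + B u = f] and the costate equation [L* p = A* (A I y - zd)] exactly,
    together with
    [(- B* I* p + lambda C u, v - u) >= 0] for every admissible [v]
    ([VI_state_eq]).  The first two terms of the squared estimator are
    therefore weighted squared norms of [L ey + B eu] and
    [L* ep - A* A I ey], where [eu = u - uh], [ey = y - yh], [ep = p - ph]
    are the errors.  Here [L*] and [I*] stand for [opLs] and [opIs].

    By the optimality condition of the projection, [ut = u_tilde lambda ph]
    satisfies the same variational inequality with [ph] in place of [p]
    ([u_tildeP]).  Adding the two inequalities gives, for [w = u - ut],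
    [(- B* I* ep + lambda C w, w) <= 0] ([control_error_monotone]).  This has
    two uses.

    - Efficiency: coercivity of [C] yields
      [lambda |w| <= const * |ep|], which bounds the last term of the
      estimator; the first two are bounded by continuity of the operators.

    - Reliability: in [a(w, ey, ep; w, ey, ep)] the nonsymmetric part is
      nonpositive, so that this value is at most a multiple of
      [lambda^-1 * eta^2], the price of replacing [eu] by [w = eu - (ut - uh)].
      Coercivity of [a] in the [lambda]-weighted norm bounds [w],
      [ey - state w] and [ep - costate ey], and boundedness of [state] and
      [costate] then bounds the errors themselves.

    Two facts of functional analysis enter.  The projection and the inverse of
    [C] exist because a coercive quadratic functional attains its minimum on a
    nonempty closed convex set ([energy_minimiser]).  The inverses of [L] and
    [L*] are bounded; this follows from the coercivity of [a] itself at
    [lambda = 1] ([opL_opLs_inverse_bounded]), without the open mapping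
    theorem. *)

(** * Inner product and bounded operators *)

Section inner_product.
Context (R : realType) (V : hilbertType R).
Implicit Types (x y z : V) (a t : R).

Lemma ip_sym x y : ip x y = ip y x.
Proof. by rewrite /ip hermC /= expr0 mul1r. Qed.

Lemma ipDl x y z : ip (x + y) z = ip x z + ip y z.
Proof. by rewrite /ip linearDl. Qed.

Lemma ipZl a x y : ip (a *: x) y = a * ip x y.
Proof. by rewrite /ip linearZl_LR. Qed.

Lemma ipNl x y : ip (- x) y = - ip x y.
Proof. by rewrite /ip linearNl. Qed.

Lemma ipDr x y z : ip x (y + z) = ip x y + ip x z.
Proof. by rewrite ![ip x _]ip_sym ipDl. Qed.

Lemma ipZr a x y : ip x (a *: y) = a * ip x y.
Proof. by rewrite ![ip x _]ip_sym ipZl. Qed.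

Lemma ipNr x y : ip x (- y) = - ip x y.
Proof. by rewrite ![ip x _]ip_sym ipNl. Qed.

Lemma ip0l x : ip 0 x = 0.
Proof. by rewrite -(scale0r 0) ipZl mul0r. Qed.

Lemma ip0r x : ip x 0 = 0.
Proof. by rewrite ip_sym ip0l. Qed.

Lemma ipxx x : ip x x = `|x| ^+ 2.
Proof. by rewrite normr_inner. Qed.

Lemma ip_inj x : (forall y, ip x y = 0) -> x = 0.
Proof.
by move=> /(_ x); rewrite ipxx => /eqP; rewrite sqrf_eq0 normr_eq0 => /eqP.
Qed.

Lemma Cauchy_Schwarz x y : `|ip x y| <= `|x| * `|y|.
Proof.
have [->|x0] := eqVneq x 0; first by rewrite ip0l !normr0 mul0r.
rewrite -ler_sqr ?nnegrE ?mulr_ge0// -normrX exprMn.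
rewrite ger0_norm ?sqr_ge0//.
have xx : 0 < `|x| ^+ 2 by rewrite exprn_gt0 ?normr_gt0.
have : 0 <= ip (ip x y *: x - `|x| ^+ 2 *: y) (ip x y *: x - `|x| ^+ 2 *: y).
  by rewrite ipxx sqr_ge0.
rewrite !(ipDl, ipDr, ipNl, ipNr, ipZl, ipZr) !ipxx (ip_sym y x) => h.
by rewrite -(ler_pM2l xx); lra.
Qed.

Lemma le_normM_ip x y : ip x y <= `|x| * `|y|.
Proof. exact: le_trans (ler_norm _) (Cauchy_Schwarz _ _). Qed.

Lemma convex_comb (K : set V) x y t : closed_convex K -> K x -> K y ->
  0 <= t -> t <= 1 -> K (t *: x + (1 - t) *: y).
Proof.
move=> [_ _ cK] /mem_set Kx /mem_set Ky t0 t1.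
have := cK x y (Itv01 t0 t1) Kx Ky.
by rewrite inE.
Qed.

End inner_product.

Lemma sqr_normD_le (R : realType) (V : normedModType R) (x y : V) :
  `|x + y| ^+ 2 <= 2 * `|x| ^+ 2 + 2 * `|y| ^+ 2.
Proof.
have := ler_normD x y; have := normr_ge0 (x + y) => h0 h1.
apply: (@le_trans _ _ ((`|x| + `|y|) ^+ 2)); first by rewrite ler_sqr ?nnegrE//; lra.
have := sqr_ge0 (`|x| - `|y|); lra.
Qed.

(** Boundedness with an explicit positive constant. *)
Definition norm_bounded (R : realType) (V W : normedModType R) (f : V -> W) :=
  exists2 M : R, 0 < M & forall x, `|f x| <= M * `|x|.

Lemma bounded_near_norm_bounded (R : realType) (V W : normedModType R)
  (f : {linear V -> W}) : bounded_near f (nbhs 0) -> norm_bounded f.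
Proof.
by move=> /linear_boundedP /pinfty_ex_gt0 [M M0 hM]; exists M.
Qed.

Lemma norm_bounded_sqr (R : realType) (V W : normedModType R) (f : V -> W) :
  norm_bounded f ->
  exists2 M : R, 0 < M & forall x, `|f x| ^+ 2 <= M * `|x| ^+ 2.
Proof.
move=> [M M0 hM]; exists (M ^+ 2) => [|x]; first exact: exprn_gt0.
by rewrite -exprMn ler_sqr ?nnegrE// mulr_ge0// ltW.
Qed.

Lemma norm_bounded_comp (R : realType) (U V W : normedModType R)
  (g : V -> W) (f : U -> V) :
  norm_bounded f -> norm_bounded g -> norm_bounded (g \o f).
Proof.
move=> [M M0 hM] [N N0 hN]; exists (N * M); first exact: mulr_gt0.
by move=> x /=; rewrite (le_trans (hN _))// -mulrA ler_pM2l.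
Qed.

(** An adjoint inherits the bound of the operator, since
    [|T' x|^2 = (T (T' x), x)]. *)
Lemma adjoint_norm_bounded (R : realType) (V W : hilbertType R)
  (T : V -> W) (T' : W -> V) :
  is_adjoint T T' -> norm_bounded T -> norm_bounded T'.
Proof.
move=> adj [M M0 hM]; exists M => // x.
have [->|x0] := eqVneq (T' x) 0; first by rewrite normr0 mulr_ge0// ltW.
have T0 : 0 < `|T' x| by rewrite normr_gt0.
rewrite -(ler_pM2l T0) -expr2 -ipxx -adj.
rewrite (le_trans (le_normM_ip _ _))// mulrCA mulrA.
by rewrite ler_wpM2r.
Qed.

(** * Minimisation of coercive quadratic functionals on convex sets *)

Section quadratic_minimisation.
Context (R : realType) (V : hilbertType R) (C : {linear V -> V}) (kappa : R).
Hypotheses (C_adj : is_adjoint C C) (kappa_gt0 : 0 < kappa)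
  (C_coercive : forall v, kappa * `|v| ^+ 2 <= ip (C v) v).
Variable F : V.
Implicit Types (u v w : V) (K : set V).

(** Twice the usual energy functional of the equation [C v = F], namely
    [(C v, v) - 2 (F, v)]. *)
Definition energy v : R := ip (C v) v - 2 * ip F v.

Lemma energyE u v :
  energy (u + v) = energy u + 2 * ip (C u - F) v + ip (C v) v.
Proof.
rewrite /energy linearD !(ipDl, ipDr, ipNl) (C_adj v u) (ip_sym v (C u)).
ring.
Qed.

Lemma energy_lbound v : - (`|F| ^+ 2 / kappa) <= energy v.
Proof.
have h1 := C_coercive v; have h2 := le_normM_ip F v.
have h3 : 0 <= kappa * (`|v| - `|F| / kappa) ^+ 2.
  by rewrite mulr_ge0 ?sqr_ge0// ltW.
have h4 : kappa * (`|v| - `|F| / kappa) ^+ 2 =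
  kappa * `|v| ^+ 2 - 2 * (`|F| * `|v|) + `|F| ^+ 2 / kappa.
  by field; exact: lt0r_neq0.
rewrite /energy; lra.
Qed.

(** The parallelogram identity for the quadratic part makes minimising
    sequences Cauchy. *)
Lemma energy_midpoint u v : kappa * `|u - v| ^+ 2 <=
  2 * (energy u + energy v - 2 * energy (2^-1 *: u + (1 - 2^-1) *: v)).
Proof.
apply: (le_trans (C_coercive _)).
have uE : u = (2^-1 *: u + (1 - 2^-1) *: v) + 2^-1 *: (u - v).
  rewrite scalerBr addrACA -scalerDl -scalerBl.
  have -> : 2^-1 + 2^-1 = 1 :> R by lra.
  have -> : 1 - 2^-1 - 2^-1 = 0 :> R by lra.
  by rewrite scale1r scale0r addr0.
have vE : v = (2^-1 *: u + (1 - 2^-1) *: v) + (- 2^-1) *: (u - v).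
  rewrite scalerBr addrACA -scalerDl -scalerBl.
  have -> : 2^-1 + - 2^-1 = 0 :> R by lra.
  have -> : 1 - 2^-1 - - 2^-1 = 1 :> R by lra.
  by rewrite scale1r scale0r add0r.
set m := 2^-1 *: u + _ in uE vE *.
have := energyE m (2^-1 *: (u - v)); rewrite -uE => ->.
have := energyE m (- 2^-1 *: (u - v)); rewrite -vE => ->.
rewrite ![C (_ *: _)]linearZ !(ipZl, ipZr); lra.
Qed.

Lemma energy_minimiser K : closed_convex K ->
  exists2 u, K u & forall v, K v -> energy u <= energy v.
Proof.
move=> cK; have [[x0 Kx0] clK _] := cK.
pose E := energy @` K.
have lbE : has_lbound E.
  by exists (- (`|F| ^+ 2 / kappa)) => _ [v _ <-]; exact: energy_lbound.
have infE : has_inf E by split=> //; exists (energy x0), x0.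
have le_inf v : K v -> inf E <= energy v.
  by move=> Kv; apply: ge_inf => //; exists v.
have [delta delta0 delta_cvg] : exists2 delta : nat -> R, forall n, 0 < delta n &
    forall e, 0 < e -> exists N, forall n, (N <= n)%N -> delta n < e.
  exists (fun n => n.+1%:R^-1) => [n|e e0]; first by rewrite invr_gt0.
  by have [N _ hN] := near_infty_natSinv_lt (PosNum e0); exists N.
have /choice [x hx] : forall n, exists v, K v /\ energy v < inf E + delta n.
  by move=> n; have /inf_adherent/(_ infE)[_ [v Kv <-] hv] := delta0 n; exists v.
have dist_x n k : kappa * `|x n - x k| ^+ 2 <= 2 * (delta n + delta k).
  have [Kn en] := hx n; have [Kk ek] := hx k.
  have Km : K (2^-1 *: x n + (1 - 2^-1) *: x k) by apply: convex_comb => //; lra.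
  have h1 := energy_midpoint (x n) (x k); have h2 := le_inf _ Km.
  lra.
have cvg_x : cvgn x.
  apply/cauchy_cvgP; apply/cauchy_ballP => e e0; near_simpl.
  have d0 : 0 < kappa * e ^+ 2 / 4 by rewrite divr_gt0 ?mulr_gt0 ?exprn_gt0.
  have [N hN] := delta_cvg _ d0.
  exists ([set n | N <= n], [set n | N <= n])%N; first by split; exists N.
  move=> [n k] [/= Nn Nk]; rewrite -ball_normE/=.
  have := dist_x n k; have /= := hN _ Nn; have /= := hN _ Nk => h1 h2 h3.
  rewrite -ltr_sqr ?nnegrE ?(ltW e0)// -(ltr_pM2l kappa_gt0).
  lra.
pose u := limn x; have xu : x @ \oo --> u by [].
have Ku : K u.
  by apply: (closed_cvg K clK _ _ xu); apply: nearW => n; case: (hx n).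
exists u => // v Kv; apply: (le_trans _ (le_inf _ Kv)).
(* energy u - energy (x n) is at most 2 |C u - F| |u - x n|, by [energyE] *)
apply/ler_addgt0Pr => e e0.
pose c := 2 * `|C u - F|.
have c0 : 0 < c + 1 by rewrite ltr_wpDl// mulr_ge0.
have ec0 : 0 < e / 2 / (c + 1) by rewrite !divr_gt0.
have e20 : 0 < e / 2 by rewrite divr_gt0.
have [N1 hN1] := delta_cvg _ e20.
move/cvgrPdist_le : xu => /(_ _ ec0)[N2 _ hN2].
pose n := maxn N1 N2.
have /= h1 := hN1 n (leq_maxl _ _); have /= h2 := hN2 n (leq_maxr _ _).
have [_ h3] := hx n.
have h4 : energy (x n) = energy u + 2 * ip (C u - F) (x n - u)
    + ip (C (x n - u)) (x n - u) by rewrite -energyE subrKC.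
have h5 : 0 <= ip (C (x n - u)) (x n - u).
  by apply: le_trans (C_coercive _); rewrite mulr_ge0 ?sqr_ge0// ltW.
have h6 := Cauchy_Schwarz (C u - F) (x n - u).
rewrite (distrC (x n)) in h6.
have h7 : c * `|u - x n| <= e / 2.
  apply: (@le_trans _ _ ((c + 1) * `|u - x n|)).
    by rewrite ler_wpM2r// lerDl.
  by rewrite mulrC -ler_pdivlMr.
have h8 := ler_norm (- ip (C u - F) (x n - u)); rewrite normrN in h8.
rewrite /c in h7; lra.
Unshelve. all: by end_near. Qed.

(** First-order optimality condition of a constrained minimiser. *)
Lemma minimiser_VI K u : closed_convex K -> K u ->
  (forall v, K v -> energy u <= energy v) ->
  forall v, K v -> 0 <= ip (C u - F) (v - u).
Proof.
move=> cK Ku umin v Kv; rewrite leNgt; apply/negP => b0.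
set b := ip _ _ in b0; pose c := ip (C (v - u)) (v - u).
have c0 : 0 <= c.
  by apply: le_trans (C_coercive _); rewrite mulr_ge0 ?sqr_ge0// ltW.
(* for this step t <= 1 the curvature term t * c is at most - b, so that
   moving from u towards v would strictly decrease the energy *)
pose t := - b / (c - b).
have cb0 : 0 < c - b by lra.
have t0 : 0 < t by rewrite divr_gt0//; lra.
have t1 : t <= 1 by rewrite ler_pdivrMr//; lra.
have := umin _ (convex_comb cK Kv Ku (ltW t0) t1).
have -> : t *: v + (1 - t) *: u = u + t *: (v - u).
  by rewrite scalerBl scale1r scalerBr addrCA addrA.
rewrite energyE [C (_ *: _)]linearZ !(ipZl, ipZr) -/b -/c => h.
have h1 : 0 <= t * (2 * b + t * c) by lra.
rewrite pmulr_rge0// in h1.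
have h2 : t * c <= - b.
  have tE : t * (c - b) = - b by rewrite divfK// lt0r_neq0.
  have : t * b <= 0 by rewrite pmulr_rle0// ltW.
  lra.
lra.
Qed.

(** The unconstrained minimiser solves the equation. *)
Lemma coercive_surjective : exists v, C v = F.
Proof.
have cT : closed_convex [set: V].
  by split; [exists 0 | exact: closedT | move=> x y t _ _; rewrite inE].
have [u _ umin] := energy_minimiser cT; exists u.
have h := minimiser_VI cT I umin.
apply/eqP; rewrite -subr_eq0; apply/eqP/ip_inj => v.
have h1 := h (u + v) I; have h2 := h (u - v) I.
rewrite addrAC subrr add0r in h1; rewrite addrAC subrr add0r ipNr in h2.
by apply/eqP; rewrite eq_le; lra.
Qed.

End quadratic_minimisation.
(** * The operators of the optimality system *)

Section optimality_system.
Context (R : realType) (S : setting R).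
Implicit Types (u v : spX S) (y z : spY S) (p q : spYs S).

Lemma opL_state u : opL S (state u) = - opB S u.
Proof.
rewrite /state; apply: (@xgetPex _ 0 [set y | opL S y = - opB S u]).
have [g _ gK] := opL_bijective S; exists (g (- opB S u)); exact: gK.
Qed.

Lemma opLs_costate y : opLs S (costate y) = opA' S (opA S (opI S y)).
Proof.
rewrite /costate.
apply: (@xgetPex _ 0 [set p | opLs S p = opA' S (opA S (opI S y))]).
have [g _ gK] := opLs_bijective S; exists (g (opA' S (opA S (opI S y)))).
exact: gK.
Qed.

Lemma state0 : state (0 : spX S) = 0.
Proof.
by apply: (bij_inj (opL_bijective S)); rewrite opL_state !linear0.
Qed.

Lemma costate0 : costate (0 : spY S) = 0.
Proof. by apply: (bij_inj (opLs_bijective S)); rewrite opLs_costate !linear0. Qed.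

Lemma opC_invK (w : spX S) : opC S (opC_inv w) = w.
Proof.
rewrite /opC_inv; apply: (@xgetPex _ 0 [set u | opC S u = w]).
have [kappa kappa0 hC] := opC_coercive S.
exact: (coercive_surjective (@opC_selfadjoint R S) kappa0 hC w).
Qed.

(** Existence of the projection in the inner product of [opC], and its
    variational characterisation. *)
Lemma projXadP (w : spX S) : Xad S (projXad w) /\
  forall v, Xad S v -> 0 <= ip (opC S (projXad w) - opC S w) (v - projXad w).
Proof.
have [kappa kappa0 hC] := opC_coercive S; have adj := @opC_selfadjoint R S.
have cK := Xad_closed_convex S.
(* the distance to w is the energy for F = C w, up to a constant *)
have energyE' v : ipC (v - w) (v - w)
    = energy (opC S) (opC S w) v + ip (opC S w) w.
  rewrite /ipC /energy linearB !(ipDl, ipDr, ipNl, ipNr) (adj v w).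
  rewrite (ip_sym v (opC S w)); ring.
have [Kp hp] : [set u | Xad S u /\
    forall v, Xad S v -> ipC (u - w) (u - w) <= ipC (v - w) (v - w)] (projXad w).
  apply: xgetPex.
  have [u Ku umin] := energy_minimiser adj kappa0 hC (opC S w) cK.
  by exists u; split=> // v Kv; rewrite !energyE' lerD2r umin.
split=> //; apply: (minimiser_VI adj kappa0 hC cK Kp) => v Kv.
by have := hp v Kv; rewrite !energyE' lerD2r.
Qed.

(** [u_tilde lambda p] satisfies the variational inequality of the optimal
    control with costate [p]. *)
Lemma u_tildeP lambda p : 0 < lambda -> Xad S (u_tilde lambda p) /\
  forall v, Xad S v ->
  0 <= ip (- opB' S (opIs S p) + lambda *: opC S (u_tilde lambda p))
          (v - u_tilde lambda p).
Proof.
move=> l0; rewrite /u_tilde; set w := lambda^-1 *: _.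
have [Kp hp] := projXadP w; split=> // v Kv.
have -> : - opB' S (opIs S p) = - (lambda *: opC S w).
  by rewrite /w [opC S (_ *: _)]linearZ/= opC_invK scalerA divff ?scale1r// lt0r_neq0.
rewrite addrC -scalerBr ipZl; apply: mulr_ge0; first exact: ltW.
exact: hp.
Qed.

(** States and costates being unconstrained and [opL], [opLs] onto, both
    residuals of a solution vanish. *)
Lemma VI_state_eq lambda alpha beta f zd u y p : 0 < alpha -> 0 < beta ->
  is_VI_solution lambda alpha beta f zd u y p ->
  [/\ opL S y + opB S u = f,
      opLs S p = opA' S (opA S (opI S y) - zd) &
      forall v, Xad S v ->
        0 <= ip (- opB' S (opIs S p) + lambda *: opC S u) (v - u)].
Proof.
move=> al0 be0 [Xu hVI].
pose r1 := opL S y + opB S u - f.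
pose r2 := opLs S p - opA' S (opA S (opI S y)) + opA' S zd.
have VI v z q : Xad S v ->
   0 <= alpha * ip r1 (opL S (z - y) + opB S (v - u))
    + beta * ip r2 (opLs S (q - p) - opA' S (opA S (opI S (z - y))))
    + ip (- opB' S (opIs S p) + lambda *: opC S u) (v - u).
  move=> /(hVI v z q); rewrite /l_form /a_form /r1 /r2.
  rewrite (ipDl (opL S y + opB S u)) (ipDl (_ - _) (opA' S zd)) !ipNl; lra.
have [gL _ gLK] := opL_bijective S; have [gs _ gsK] := opLs_bijective S.
have r20 : r2 = 0.
  apply: ip_inj => w.
  have h t : 0 <= t * ip r2 w.
    have := VI u y (p + gs (t *: w)) Xu.
    rewrite [p + _ - p]addrAC !subrr add0r !linear0 gsK !addr0 !ip0r ipZr.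
    rewrite mulr0 add0r addr0; rewrite pmulr_rge0//.
  by have := h 1; have := h (-1); lra.
have r10 : r1 = 0.
  apply: ip_inj => w.
  have h t : 0 <= t * ip r1 w.
    have := VI u (y + gL (t *: w)) p Xu.
    rewrite r20 [y + _ - y]addrAC !subrr add0r gLK !linear0 addr0 ip0l ip0r ipZr.
    by rewrite mulr0 !addr0 pmulr_rge0.
  by have := h 1; have := h (-1); lra.
split.
- exact/subr0_eq.
- by apply/subr0_eq; rewrite linearB opprB addrCA addrC -[RHS]r20.
- move=> v Kv; have := VI v y p Kv.
  by rewrite r10 r20 !ip0l !mulr0 !add0r.
Qed.

(** At [lambda = 1] and for a vanishing control, coercivity reads
    [|y|^2 + |p - costate y|^2 <= c * (alpha * |L y|^2 + beta * |L* (p - costate y)|^2)];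
    the choices [p = costate y] and [y = 0] bound the inverses of [opL] and
    [opLs]. *)
Lemma opL_opLs_inverse_bounded alpha0 beta0 : thresholds S alpha0 beta0 ->
  (exists2 M : R, 0 < M & forall y, `|y| ^+ 2 <= M * `|opL S y| ^+ 2) /\
  (exists2 M : R, 0 < M & forall p, `|p| ^+ 2 <= M * `|opLs S p| ^+ 2).
Proof.
move=> [ha hb [c c0 hc] _].
have l1 : 0 < (1 : R) <= 1 by rewrite ltr01 lexx.
have a0 : 0 < alpha0 1.
  have [k [K [k0 _ /(_ _ l1)/andP[+ _]]]] := ha.
  by apply: lt_le_trans; rewrite mulr1.
have b0 : 0 < beta0 1.
  have [k [K [k0 _ /(_ _ l1)/andP[+ _]]]] := hb.
  by apply: lt_le_trans; rewrite invr1 mulr1.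
have {}hc y p := hc 1 _ _ l1 (lexx _) (lexx _) 0 y p.
have normE y p : lambda_norm 1 0 y p ^+ 2 = `|y| ^+ 2 + `|p - costate y| ^+ 2.
  rewrite /lambda_norm state0 subr0 !linear0 !normr0 invr1 expr0n/= mulr0 mul1r.
  by rewrite add0r addr0 sqr_sqrtr// addr_ge0// sqr_ge0.
split; [exists (c * alpha0 1) => [|y]| exists (c * beta0 1) => [|p]].
- exact: mulr_gt0.
- have := hc y (costate y); rewrite normE subrr normr0 expr0n/= addr0.
  rewrite /a_form opLs_costate subrr !linear0 !addr0 !ip0r mulr0 !addr0 ipxx.
  by rewrite mulrA.
- exact: mulr_gt0.
- have := hc 0 p; rewrite normE costate0 subr0 normr0 expr0n/= add0r.
  by rewrite /a_form !linear0 !addr0 !ip0r mulr0 !add0r addr0 ipxx mulrA.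
Qed.

(** [M] bounds the squared operator norms of all operators in the estimates. *)
Record bounds (M : R) : Prop := Bounds {
  bound_gt0 : 0 < M;
  bound_L : forall y, `|opL S y| ^+ 2 <= M * `|y| ^+ 2;
  bound_Ls : forall p, `|opLs S p| ^+ 2 <= M * `|p| ^+ 2;
  bound_B : forall u, `|opB S u| ^+ 2 <= M * `|u| ^+ 2;
  bound_AI : forall y, `|opA' S (opA S (opI S y))| ^+ 2 <= M * `|y| ^+ 2;
  bound_BI : forall p, `|opB' S (opIs S p)| ^+ 2 <= M * `|p| ^+ 2;
  bound_state : forall u, `|state u| ^+ 2 <= M * `|u| ^+ 2;
  bound_costate : forall y, `|costate y| ^+ 2 <= M * `|y| ^+ 2 }.


Lemma exists_bounds alpha0 beta0 : thresholds S alpha0 beta0 ->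
  exists M, bounds M.
Proof.
move=> /opL_opLs_inverse_bounded[[m1 m10 h1] [m2 m20 h2]].
have nA := bounded_near_norm_bounded (opA_bounded S).
have nB := bounded_near_norm_bounded (opB_bounded S).
have nI := bounded_near_norm_bounded (opI_bounded S).
have nIs := bounded_near_norm_bounded (opIs_bounded S).
have nA' := adjoint_norm_bounded (@opA_adjoint R S) nA.
have nB' := adjoint_norm_bounded (@opB_adjoint R S) nB.
have [m3 m30 h3] := norm_bounded_sqr (bounded_near_norm_bounded (opL_bounded S)).
have [m4 m40 h4] := norm_bounded_sqr (bounded_near_norm_bounded (opLs_bounded S)).
have [m5 m50 h5] := norm_bounded_sqr nB.
have [m6 m60 h6] := norm_bounded_sqr (norm_bounded_comp (norm_bounded_comp nI nA) nA').
have [m7 m70 h7] := norm_bounded_sqr (norm_bounded_comp nIs nB').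
have le_M m M (a b : R) : 0 <= b -> m <= M -> a <= m * b -> a <= M * b.
  by move=> b0 mM h; rewrite (le_trans h)// ler_wpM2r.
have m150 : 0 < m1 * m5 by exact: mulr_gt0.
have m260 : 0 < m2 * m6 by exact: mulr_gt0.
exists (m3 + m4 + m5 + m6 + m7 + m1 * m5 + m2 * m6); split.
- lra.
- by move=> y; apply: le_M (h3 y); rewrite ?sqr_ge0//; lra.
- by move=> p; apply: le_M (h4 p); rewrite ?sqr_ge0//; lra.
- by move=> u; apply: le_M (h5 u); rewrite ?sqr_ge0//; lra.
- by move=> y; apply: le_M (h6 y); rewrite ?sqr_ge0//; lra.
- by move=> p; apply: le_M (h7 p); rewrite ?sqr_ge0//; lra.
- move=> u; apply: (@le_M (m1 * m5)); rewrite ?sqr_ge0//; first lra.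
  rewrite (le_trans (h1 _))// opL_state normrN -mulrA ler_pM2l//; exact: h5.
- move=> y; apply: (@le_M (m2 * m6)); rewrite ?sqr_ge0//; first lra.
  rewrite (le_trans (h2 _))// opLs_costate -mulrA ler_pM2l//; exact: h6.
Qed.

(** * Reliability and efficiency *)

Section error_estimates.
Variables (M lambda alpha beta : R) (f : spZ S) (zd : spH S).
Variables (u uh : spX S) (y yh : spY S) (p ph : spYs S).
Hypotheses (hM : bounds M) (l0 : 0 < lambda) (l1 : lambda <= 1)
  (al0 : 0 < alpha) (be0 : 0 < beta)
  (hVI : is_VI_solution lambda alpha beta f zd u y p).

(* [ut] is the projected control of the estimator, [eta2] the squared
   estimator, [err2] the squared product norm of the error. *)
Let ut := u_tilde lambda ph.
Let eta2 := alpha * `|opL S yh + opB S uh - f| ^+ 2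
            + beta * `|opLs S ph - opA' S (opA S (opI S yh) - zd)| ^+ 2
            + lambda * `|ut - uh| ^+ 2.
Let err2 := `|u - uh| ^+ 2 + `|y - yh| ^+ 2 + `|p - ph| ^+ 2.

Lemma state_residualE :
  opL S yh + opB S uh - f = - (opL S (y - yh) + opB S (u - uh)).
Proof.
have [<- _ _] := VI_state_eq al0 be0 hVI.
by rewrite !linearB/= addrACA -opprD opprB.
Qed.

Lemma costate_residualE :
  opLs S ph - opA' S (opA S (opI S yh) - zd) =
  - (opLs S (p - ph) - opA' S (opA S (opI S (y - yh)))).
Proof.
have [_ h _] := VI_state_eq al0 be0 hVI.
have hAI : opA' S (opA S (opI S (y - yh))) =
  opA' S (opA S (opI S y)) - opA' S (opA S (opI S yh)) by rewrite !linearB.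
rewrite hAI [opLs S (p - ph)]linearB h ![opA' S (_ - zd)]linearB/=.
set a := opA' S (opA S (opI S y)); set b := opA' S (opA S _).
set d := opLs S ph; set e := opA' S zd.
rewrite [RHS]opprB -(addrA a (- e)) -opprD (opprB a) [RHS]addrC subrKA.
by rewrite opprB addrA (addrC e).
Qed.

(** Sum of the variational inequality of [u], tested with [ut], and that of
    [ut], tested with [u]. *)
Lemma control_error_monotone :
  ip (- opB' S (opIs S (p - ph)) + lambda *: opC S (u - ut)) (u - ut) <= 0.
Proof.
have [_ _ hu] := VI_state_eq al0 be0 hVI; have [Xu _] := hVI.
have [Xt ht] := u_tildeP ph l0.
have h1 := hu _ Xt; have h2 := ht _ Xu.
rewrite -/ut in h1 h2.
rewrite -(opprB u ut) ipNr in h1.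
rewrite !linearB/=.
rewrite !(ipDl, ipNl, ipZl) in h1 h2 *; lra.
Qed.

Lemma control_error_le kappa : 0 < kappa ->
  (forall v, kappa * `|v| ^+ 2 <= ip (opC S v) v) ->
  lambda ^+ 2 * `|u - ut| ^+ 2 <= M / kappa ^+ 2 * `|p - ph| ^+ 2.
Proof.
move=> k0 hC; have := control_error_monotone.
rewrite ipDl ipNl ipZl; set w := u - ut; set b := opB' S _ => h.
have h1 : lambda * (kappa * `|w| ^+ 2) <= `|b| * `|w|.
  have := le_normM_ip b w; have : lambda * (kappa * `|w| ^+ 2) <= lambda * ip (opC S w) w.
    by rewrite ler_pM2l.
  lra.
have h2 : lambda * kappa * `|w| <= `|b|.
  have [->|w0] := eqVneq w 0; first by rewrite normr0 mulr0.
  have w0' : 0 < `|w| by rewrite normr_gt0.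
  by rewrite -(ler_pM2r w0'); lra.
rewrite [leRHS]mulrAC ler_pdivlMr ?exprn_gt0//.
apply: le_trans (bound_BI hM (p - ph)); rewrite -/b.
rewrite [leLHS]mulrAC -!exprMn ler_sqr ?nnegrE// !mulr_ge0//; exact: ltW.
Qed.

(** Efficiency, squared and multiplied by [lambda]. *)
Lemma efficiency_sqr kappa Ca Cb : 0 < kappa ->
  (forall v, kappa * `|v| ^+ 2 <= ip (opC S v) v) ->
  alpha <= Ca -> lambda * beta <= Cb ->
  lambda * eta2 <= (2 * M * Ca + 2 * M * Cb + 2 * (M / kappa ^+ 2) + 2) * err2.
Proof.
move=> k0 hC aC bC; have M0 := bound_gt0 hM.
rewrite /eta2 state_residualE costate_residualE !normrN.
have hw := control_error_le k0 hC.
set r1 := `|_ + _| ^+ 2; set r2 := `|_ - opA' S _| ^+ 2.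
set d := `|ut - uh| ^+ 2.
have [eu0 ey0 ep0] : [/\ 0 <= `|u - uh| ^+ 2, 0 <= `|y - yh| ^+ 2 &
  0 <= `|p - ph| ^+ 2] by rewrite !sqr_ge0.
have err0 : 0 <= err2 by rewrite /err2; lra.
have r1_ge0 : 0 <= r1 by exact: sqr_ge0.
have r2_ge0 : 0 <= r2 by exact: sqr_ge0.
have d0 : 0 <= d by exact: sqr_ge0.
have r1_le : r1 <= 2 * M * err2.
  have h1 := bound_L hM (y - yh); have h2 := bound_B hM (u - uh).
  apply: (le_trans (sqr_normD_le _ _)); rewrite /err2.
  have := mulr_ge0 (ltW M0) ep0; lra.
have r2_le : r2 <= 2 * M * err2.
  have h1 := bound_Ls hM (p - ph); have h2 := bound_AI hM (y - yh).
  apply: (le_trans (sqr_normD_le _ _)); rewrite normrN /err2.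
  have := mulr_ge0 (ltW M0) eu0; lra.
have h1 : lambda * (alpha * r1) <= Ca * (2 * M * err2).
  apply: (@le_trans _ _ (alpha * r1)); first by rewrite ler_piMl ?mulr_ge0// ltW.
  by rewrite ler_pM// ltW.
have h2 : lambda * (beta * r2) <= Cb * (2 * M * err2).
  by rewrite mulrA ler_pM// mulr_ge0// ltW.
have h3 : lambda ^+ 2 * d <= 2 * (M / kappa ^+ 2 * `|p - ph| ^+ 2) + 2 * `|u - uh| ^+ 2.
  have hd : d <= 2 * `|u - ut| ^+ 2 + 2 * `|u - uh| ^+ 2.
    by rewrite /d -(subrKA u) addrC (distrC u ut) addrC; exact: sqr_normD_le.
  have l2 : lambda ^+ 2 <= 1 by rewrite expr_le1// ltW.
  have l20 : 0 < lambda ^+ 2 by rewrite exprn_gt0.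
  have := ler_wpM2l (ltW l20) hd; have := ler_wpM2r eu0 l2; lra.
have Mk0 : 0 <= M / kappa ^+ 2 by rewrite divr_ge0 ?sqr_ge0// ltW.
have h4 := mulr_ge0 Mk0 ey0; have h5 := mulr_ge0 Mk0 eu0.
move: h1 h2 h3 h4 h5; rewrite /err2; set m := M / _; lra.
Qed.

(** Reliability, squared; the premise with constant [c] is the coercivity of the
    bilinear form at [(u - ut, y - yh, p - ph)]. *)
Lemma reliability_sqr c c1 Ca : 0 < c -> alpha <= Ca ->
  c1 = c * (3 + 2 * M * Ca) ->
  lambda_norm lambda (u - ut) (y - yh) (p - ph) ^+ 2 <=
    c * a_form lambda alpha beta (u - ut) (y - yh) (p - ph)
                                 (u - ut) (y - yh) (p - ph) ->
  lambda ^+ 2 * err2 <= (2 * c1 + 2 + (2 * c1 + 2 * M * c1) * (1 + 2 * M)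
                         + 2 * c1) * eta2.
Proof.
move=> c0 aC c1E hc; have M0 := bound_gt0 hM.
set w := u - ut in hc *; set ey := y - yh in hc *; set ep := p - ph in hc *.
have eta2E : eta2 = alpha * `|opL S ey + opB S (u - uh)| ^+ 2 +
    beta * `|opLs S ep - opA' S (opA S (opI S ey))| ^+ 2 + lambda * `|ut - uh| ^+ 2.
  by rewrite /eta2 state_residualE costate_residualE !normrN.
set s := eta2 in eta2E *; clearbody s.
set r1 := `|_ + opB S _| ^+ 2 in eta2E; set r2 := `|_ - opA' S _| ^+ 2 in eta2E.
set d := `|ut - uh| ^+ 2 in eta2E.
have r1_ge0 : 0 <= alpha * r1 by rewrite mulr_ge0 ?sqr_ge0// ltW.
have r2_ge0 : 0 <= beta * r2 by rewrite mulr_ge0 ?sqr_ge0// ltW.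
have d0 : 0 <= lambda * d by rewrite mulr_ge0 ?sqr_ge0// ltW.
have s0 : 0 <= s by lra.
have Ca0 : 0 < Ca by exact: lt_le_trans aC.
have c10 : 0 <= c1.
  by rewrite c1E mulr_ge0 ?(ltW c0)// addr_ge0// !mulr_ge0// ltW.
have lr1 : lambda * (alpha * r1) <= alpha * r1 by rewrite ler_piMl.
have lr2 : lambda * (beta * r2) <= beta * r2 by rewrite ler_piMl.
(* replacing the control error u - uh by w costs a multiple of d *)
have rw : `|opL S ey + opB S w| ^+ 2 <= 2 * r1 + 2 * (M * d).
  have -> : opL S ey + opB S w = opL S ey + opB S (u - uh) - opB S (ut - uh).
    by rewrite -addrA -linearB/= opprB addrA subrK.
  apply: (le_trans (sqr_normD_le _ _)); rewrite normrN.
  by have := bound_B hM (ut - uh); rewrite -/d -/r1; lra.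
have norm_le : lambda * lambda_norm lambda w ey ep ^+ 2 <= c1 * s.
  have ha : a_form lambda alpha beta w ey ep w ey ep <=
      alpha * (2 * r1 + 2 * (M * d)) + beta * r2.
    rewrite /a_form !ipxx -/r2; have := control_error_monotone.
    rewrite -/w -/ep.
    have : alpha * `|opL S ey + opB S w| ^+ 2 <= alpha * (2 * r1 + 2 * (M * d)).
      by rewrite ler_pM2l.
    lra.
  have h1 : lambda * a_form lambda alpha beta w ey ep w ey ep <=
      lambda * (alpha * (2 * r1 + 2 * (M * d)) + beta * r2) by rewrite ler_pM2l.
  have h2 : alpha * (M * (lambda * d)) <= Ca * (M * (lambda * d)).
    by rewrite ler_wpM2r// mulr_ge0// ltW.
  have h3 : Ca * M * (lambda * d) <= Ca * M * s.
    by rewrite ler_pM2l ?mulr_gt0//; lra.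
  have h4 : lambda * a_form lambda alpha beta w ey ep w ey ep <= (3 + 2 * M * Ca) * s.
    lra.
  rewrite c1E -mulrA.
  apply: (@le_trans _ _ (lambda * (c * a_form lambda alpha beta w ey ep w ey ep))).
    by rewrite ler_pM2l.
  by rewrite mulrCA ler_pM2l.
have l2_le x : 0 <= x -> lambda ^+ 2 * x <= lambda * x.
  by move=> x0; rewrite expr2 -mulrA ler_piMl// mulr_ge0// ltW.
have normE : lambda_norm lambda w ey ep ^+ 2 =
   lambda * `|w| ^+ 2 + `|ey - state w| ^+ 2
    + lambda^-1 * `|ep - costate ey| ^+ 2 + `|opA S (opI S (state w))| ^+ 2.
  by rewrite /lambda_norm sqr_sqrtr// !addr_ge0 ?sqr_ge0// mulr_ge0 ?sqr_ge0 ?invr_ge0// ltW.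
have t1 : 0 <= lambda * (lambda * `|w| ^+ 2) by rewrite !mulr_ge0 ?sqr_ge0// ltW.
have t2 : 0 <= lambda * `|ey - state w| ^+ 2 by rewrite mulr_ge0 ?sqr_ge0// ltW.
have t3 : 0 <= `|ep - costate ey| ^+ 2 by rewrite sqr_ge0.
have t4 : 0 <= lambda * `|opA S (opI S (state w))| ^+ 2 by rewrite mulr_ge0 ?sqr_ge0// ltW.
rewrite normE !mulrDr (mulrA lambda lambda^-1) divff ?lt0r_neq0// mul1r in norm_le.
have w_le : lambda ^+ 2 * `|w| ^+ 2 <= c1 * s by rewrite expr2 -mulrA; lra.
have eu_le : lambda ^+ 2 * `|u - uh| ^+ 2 <= (2 * c1 + 2) * s.
  have : `|u - uh| ^+ 2 <= 2 * `|w| ^+ 2 + 2 * d.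
    by rewrite -(subrKA ut); exact: sqr_normD_le.
  move=> /(ler_wpM2l (sqr_ge0 lambda)).
  have := l2_le _ (sqr_ge0 `|ut - uh|); rewrite -/d; lra.
have ey_le : lambda ^+ 2 * `|ey| ^+ 2 <= (2 * c1 + 2 * M * c1) * s.
  have h : `|ey| ^+ 2 <= 2 * `|ey - state w| ^+ 2 + 2 * (M * `|w| ^+ 2).
    rewrite -{1}(subrK (state w) ey); apply: (le_trans (sqr_normD_le _ _)).
    by have := bound_state hM w; lra.
  have := ler_wpM2l (sqr_ge0 lambda) h.
  have := l2_le _ (sqr_ge0 `|ey - state w|).
  have := ler_wpM2l (ltW M0) w_le; lra.
have ep_le : lambda ^+ 2 * `|ep| ^+ 2 <= (2 * c1 + 2 * M * (2 * c1 + 2 * M * c1)) * s.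
  have h : `|ep| ^+ 2 <= 2 * `|ep - costate ey| ^+ 2 + 2 * (M * `|ey| ^+ 2).
    rewrite -{1}(subrK (costate ey) ep); apply: (le_trans (sqr_normD_le _ _)).
    by have := bound_costate hM ey; lra.
  have l2 : lambda ^+ 2 * `|ep - costate ey| ^+ 2 <= `|ep - costate ey| ^+ 2.
    by rewrite ler_piMl// expr_le1// ltW.
  have := ler_wpM2l (sqr_ge0 lambda) h; have := ler_wpM2l (ltW M0) ey_le; lra.
rewrite /err2 -/ey -/ep; lra.
Qed.

End error_estimates.
End optimality_system.

Lemma sqrt_le_of_sqr (R : realType) (a x y k K : R) : 0 <= a -> 0 <= x ->
  0 <= y -> 0 <= k -> k <= K ^+ 2 -> 0 <= K -> a ^+ 2 * x <= k * y ->
  a * Num.sqrt x <= K * Num.sqrt y.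
Proof.
move=> a0 x0 y0 k0 kK K0 h.
rewrite -ler_sqr ?nnegrE ?mulr_ge0 ?sqrtr_ge0// !exprMn !sqr_sqrtr//.
by rewrite (le_trans h)// ler_wpM2r.
Qed.

Lemma powR_Nhalf_sqr (R : realType) (x : R) : 0 < x ->
  (x `^ (- 2^-1)) ^+ 2 = x^-1.
Proof.
move=> x0; rewrite -powR_mulrn ?powR_ge0// -powRrM mulNr mulVf ?pnatr_eq0//.
by rewrite powR_inv1// ltW.
Qed.

Theorem theorem10 (R : realType) (S : setting R) (alpha0 beta0 : R -> R)
    (hthr : thresholds S alpha0 beta0)
    (ca Ca cb Cb : R) (hca : 0 < ca) (hCa : 0 < Ca) (hcb : 0 < cb) (hCb : 0 < Cb) :
  exists2 K : R, 0 < K &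
  forall (lambda alpha beta : R),
    0 < lambda <= 1 ->
    alpha0 lambda <= alpha -> beta0 lambda <= beta ->
    ca <= alpha <= Ca -> cb * lambda^-1 <= beta <= Cb * lambda^-1 ->
  forall (f : spZ S) (zd : spH S) (u : spX S) (y : spY S) (p : spYs S),
    is_VI_solution lambda alpha beta f zd u y p ->
  forall (Xhad : set (spX S)) (Yh : set (spY S)) (Ysh : set (spYs S)),
    Xhad `<=` Xad S -> closed_convex Xhad ->
    closed_subspace Yh -> closed_subspace Ysh ->
  forall (uh : spX S) (yh : spY S) (ph : spYs S),
    Xhad uh -> Yh yh -> Ysh ph ->
    lambda * prod_norm (u - uh) (y - yh) (p - ph)
      <= K * estimator lambda alpha beta f zd uh yh ph /\
    estimator lambda alpha beta f zd uh yh ph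
      <= K * (lambda `^ (- 2^-1) * prod_norm (u - uh) (y - yh) (p - ph)).
Proof.
have [M hM] := exists_bounds hthr; have M0 := bound_gt0 hM.
have [kappa k0 hC] := opC_coercive S.
have [_ _ [c c0 hc] _] := hthr.
pose c1 := c * (3 + 2 * M * Ca).
pose K1 := 2 * c1 + 2 + (2 * c1 + 2 * M * c1) * (1 + 2 * M) + 2 * c1.
pose K2 := 2 * M * Ca + 2 * M * Cb + 2 * (M / kappa ^+ 2) + 2.
have c10 : 0 < c1 by rewrite mulr_gt0// addr_gt0// !mulr_gt0.
have K10 : 0 < K1.
  by rewrite /K1; have := mulr_gt0 M0 c10; have := mulr_gt0 M0 (mulr_gt0 M0 c10); lra.
have Mk0 : 0 < M / kappa ^+ 2 by rewrite divr_gt0 ?exprn_gt0.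
have K20 : 0 < K2.
  by rewrite /K2; have := mulr_gt0 M0 hCa; have := mulr_gt0 M0 hCb; lra.
have le_sqr (a b : R) : 0 < a -> 0 < b ->
    [/\ a <= (1 + a + b) ^+ 2, b <= (1 + a + b) ^+ 2 & 0 < 1 + a + b].
  move=> a0 b0; have ab0 : 0 < a * b by exact: mulr_gt0.
  by have := sqr_ge0 a; have := sqr_ge0 b; split; lra.
have [K1K K2K K0] := le_sqr _ _ K10 K20.
exists (1 + K1 + K2) => //.
move=> lambda alpha beta /andP[l0 l1] al_ge be_ge /andP[ca_le al_le]
  /andP[cb_le be_le] f zd u y p hVI Xhad Yh Ysh _ _ _ _ uh yh ph _ _ _.
have al0 : 0 < alpha by exact: lt_le_trans ca_le.
have be0 : 0 < beta.
  by apply: lt_le_trans cb_le; rewrite mulr_gt0// invr_gt0.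
have l01 : 0 < lambda <= 1 by rewrite l0.
have eta0 : 0 <= alpha * `|opL S yh + opB S uh - f| ^+ 2
    + beta * `|opLs S ph - opA' S (opA S (opI S yh) - zd)| ^+ 2
    + lambda * `|u_tilde lambda ph - uh| ^+ 2.
  by rewrite !addr_ge0// mulr_ge0 ?sqr_ge0// ltW.
have err0 : 0 <= `|u - uh| ^+ 2 + `|y - yh| ^+ 2 + `|p - ph| ^+ 2.
  by rewrite !addr_ge0// sqr_ge0.
rewrite /estimator /prod_norm; split.
  apply: (sqrt_le_of_sqr (ltW l0) err0 eta0 (ltW K10) K1K (ltW K0)).
  have := @reliability_sqr _ _ M lambda alpha beta f zd u uh y yh p ph hM l0 l1 al0
    be0 hVI _ _ _ c0 al_le erefl (hc _ _ _ l01 al_ge be_ge _ _ _).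
  exact.
rewrite mulrA -[leLHS]mul1r.
apply: (sqrt_le_of_sqr (k := K2 * lambda^-1)) => //.
- by rewrite mulr_ge0// ?invr_ge0 ltW.
- by rewrite exprMn powR_Nhalf_sqr// ler_wpM2r// invr_ge0 ltW.
- by rewrite mulr_ge0 ?powR_ge0// ltW.
rewrite expr1n mul1r [leRHS]mulrAC ler_pdivlMr// [leLHS]mulrC.
apply: (efficiency_sqr uh yh ph hM l0 l1 al0 be0 hVI k0 hC al_le).
by rewrite mulrC -ler_pdivlMr.
Qed.
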